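(* Let $d\in\{2,3\}$, let $D\subset\Omega$ be open, bounded sets in $\mathbb{R}^d$ with smooth boundaries, and let $\mu,\lambda_1,\lambda_2\in\mathbb{R}$ satisfy $\mu>0$ and $d\lambda_j+2\mu>0$ for $j=1,2$. Put $\lambda_E=\lambda_2$. Let $g=(C_g/2)\,\mathbf{x}\cdot\mathbf{x}+g_h$, where $C_g\neq 0$ is an arbitrary constant and $\Delta g_h=0$ in $\mathbb{R}^d$, and let $\mathbf{f}=\nabla g$. Suppose $\mathbf{u}$ solves $$\begin{cases}\mathcal{L}_1\mathbf{u}=0 & \text{in } D,\\ \mathcal{L}_2\mathbf{u}=0 & \text{in } \mathbb{R}^d\setminus\overline{D},\\ \mathbf{u}\ \text{and}\ \boldsymbol{\sigma}\cdot\mathbf{n}_D=(\mathcal{S}\mathbf{u})\cdot\mathbf{n}_D & \text{continuous across } \partial D,\\ \mathbf{u}-\mathbf{f}=\mathcal{O}(|\mathbf{x}|^{1-d}) & \text{as } |\mathbf{x}|\to\infty,\end{cases}$$ and let $\mathbf{u}_I=\mathbf{u}|_{\overline{\Omega}}$ and $\boldsymbol{\sigma}_I=\boldsymbol{\sigma}|_{\overline{\Omega}}$, where $\boldsymbol{\sigma}=\mathcal{S}\mathbf{u}$. Then $\mathbf{u}_I$ satisfies $$\begin{cases}\mathcal{L}_1\mathbf{u}_I=0 & \text{in } D,\\ \mathcal{L}_2\mathbf{u}_I=0 & \text{in } \Omega\setminus\overline{D},\\ \mathbf{u}_I\ \text{and}\ \boldsymbol{\sigma}_I\cdot\mathbf{n}_D=(\mathcal{S}\mathbf{u}_I)\cdot\mathbf{n}_D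 & \text{continuous across } \partial D,\\ \mathbf{P}\big(\mathbf{u}_I|_{\partial\Omega^-},(\boldsymbol{\sigma}_I|_{\partial\Omega^-})\cdot\mathbf{n}_\Omega,\mathbf{f}_0,\mathbf{F}_0\big)=0 & \text{on } \partial\Omega,\end{cases}$$ where $$\mathbf{P}\big(\mathbf{u}_I|_{\partial\Omega^-},(\boldsymbol{\sigma}_I|_{\partial\Omega^-})\cdot\mathbf{n}_\Omega,\mathbf{f}_0,\mathbf{F}_0\big)\equiv(\boldsymbol{\sigma}_I|_{\partial\Omega^-})\cdot\mathbf{n}_\Omega-\Lambda_E\big((\mathbf{u}_I|_{\partial\Omega^-})-\mathbf{f}_0\big)-\mathbf{F}_0,$$ with $\mathbf{f}_0=\mathbf{f}|_{\partial\Omega^+}$, $\mathbf{F}_0=[(\mathcal{S}_2\mathbf{f})|_{\partial\Omega^+}]\cdot\mathbf{n}_\Omega$, and $\Lambda_E$ the exterior Dirichlet-to-Neumann map.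
   Context: $\mathbf{n}_D$ and $\mathbf{n}_\Omega$ are the outward unit normals to $\partial D$ and $\partial\Omega$; $h|_{\partial\Omega^+}$ and $h|_{\partial\Omega^-}$ denote the restrictions (boundary limits) of $h$ to $\partial\Omega$ from outside and from inside $\Omega$, respectively. For $j\in\{1,2,E\}$, $\mathcal{L}_j\mathbf{u}=-(\lambda_j+\mu)\nabla(\nabla\cdot\mathbf{u})-\mu\Delta\mathbf{u}$ is the Lamé operator and $\mathcal{S}_j\mathbf{u}=\lambda_j(\nabla\cdot\mathbf{u})\mathbf{I}+\mu(\nabla\mathbf{u}+\nabla\mathbf{u}^T)$, where $\mathbf{I}$ is the identity matrix. The stress operator $\mathcal{S}$ equals $\mathcal{S}_1$ in $D$ and $\mathcal{S}_2$ in $\mathbb{R}^d\setminus\overline{D}$. The solution $\mathbf{u}:\mathbb{R}^d\to\mathbb{R}^d$ is understood to be smooth in $D$ and in $\mathbb{R}^d\setminus\overline{D}$ and continuous on $\mathbb{R}^d$, with the one-sided limits of its traction on $\partial D$ existing and agreeing; it is known to be unique. The exterior Dirichlet-to-Neumann map is defined as follows. Given a displacement $\tilde{\mathbf{u}}$ on $\partial\Omega$, let $\tilde{\mathbf{u}}_E$ solve the exterior problem $$\mathcal{L}_E\tilde{\mathbf{u}}_E=0\ \text{in } \mathbb{R}^d\setminus\overline{\Omega},\qquad \tilde{\mathbf{u}}_E=\tilde{\mathbf{u}}\ \text{on } \partial\Omega,\qquad \tilde{\mathbf{u}}_E\to 0\ \text{as } |\mathbf{x}|\to\infty.$$ Then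 $\Lambda_E(\tilde{\mathbf{u}})\equiv[(\mathcal{S}_E\tilde{\mathbf{u}}_E)|_{\partial\Omega^+}]\cdot\mathbf{n}_\Omega$. (It is understood to be applied to boundary displacements $\tilde{\mathbf{u}}$ for which this exterior problem has a solution.) *)

(* Defs.v *)
From HB Require Import structures.
From mathcomp Require Export all_boot all_order all_algebra.
From mathcomp Require Export all_classical all_reals all_analysis.
Export Order.TTheory GRing.Theory Num.Theory.
Export numFieldNormedType.Exports.

Set Implicit Arguments.
Unset Strict Implicit.
Unset Printing Implicit Defensive.

Local Open Scope classical_set_scope.
Local Open Scope ring_scope.

(* Points, displacements and tractions are row vectors 'rV[R]_d. The library
   norm on them is the max norm, so the Euclidean one is defined here. *)

Definition dotv {R : realType} {d : nat} (v w : 'rV[R]_d) : R :=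
  \sum_i v 0 i * w 0 i.

Definition enorm {R : realType} {d : nat} (v : 'rV[R]_d) : R :=
  Num.sqrt (dotv v v).

Definition bdry {T : topologicalType} (A : set T) : set T :=
  closure A `\` interior A.

(* C^oo on the open set A: every iterated directional derivative is
   differentiable at every point of A. *)
Definition smooth_on {R : realType} {V W : normedModType R}
    (A : set V) (h : V -> W) : Prop :=
  forall (s : seq V) (x : V), A x ->
    differentiable (foldr (fun v k => 'D_v k) h s) x.

Definition partial {R : realType} {d : nat} {W : normedModType R}
    (i : 'I_d) (h : 'rV[R]_d -> W) : 'rV[R]_d -> W :=
  'D_(delta_mx 0 i) h.

Definition grad {R : realType} {d : nat} (g : 'rV[R]_d -> R)
    (x : 'rV[R]_d) : 'rV[R]_d :=
  \row_i partial i g x.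

Definition divg {R : realType} {d : nat} (u : 'rV[R]_d -> 'rV[R]_d)
    (x : 'rV[R]_d) : R :=
  \sum_i partial i u x 0 i.

Definition gradm {R : realType} {d : nat} (u : 'rV[R]_d -> 'rV[R]_d)
    (x : 'rV[R]_d) : 'M[R]_d :=
  \matrix_(i, j) partial j u x 0 i.

Definition laplacian {R : realType} {d : nat} {W : normedModType R}
    (h : 'rV[R]_d -> W) (x : 'rV[R]_d) : W :=
  \sum_i partial i (partial i h) x.

Definition lame {R : realType} {d : nat} (lam mu : R)
    (u : 'rV[R]_d -> 'rV[R]_d) (x : 'rV[R]_d) : 'rV[R]_d :=
  - ((lam + mu) *: grad (divg u) x) - mu *: laplacian u x.

Definition stress {R : realType} {d : nat} (lam mu : R)
    (u : 'rV[R]_d -> 'rV[R]_d) (x : 'rV[R]_d) : 'M[R]_d :=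
  (lam * divg u x)%:M + mu *: (gradm u x + (gradm u x)^T).

(* Only meaningful off bdry D, where u need not be differentiable. *)
Definition stress2 {R : realType} {d : nat} (D : set 'rV[R]_d)
    (lam1 lam2 mu : R) (u : 'rV[R]_d -> 'rV[R]_d) (x : 'rV[R]_d) : 'M[R]_d :=
  if x \in D then stress lam1 mu u x else stress lam2 mu u x.

(* The column vector sigma(x) . n, written as a row. *)
Definition traction {R : realType} {d : nat} (sigma : 'rV[R]_d -> 'M[R]_d)
    (n x : 'rV[R]_d) : 'rV[R]_d :=
  n *m (sigma x)^T.

Definition defining_function {R : realType} {d : nat} (A : set 'rV[R]_d)
    (p : 'rV[R]_d) (phi : 'rV[R]_d -> R) : Prop :=
  exists U : set 'rV[R]_d,
    [/\ open_nbhs p U, smooth_on U phi, grad phi p != 0 &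
        forall x, U x -> (A x <-> phi x < 0)].

Definition smooth_boundary {R : realType} {d : nat} (A : set 'rV[R]_d) : Prop :=
  forall p, bdry A p -> exists phi, defining_function A p phi.

(* The gradient of a local defining function of A points out of A; the
   normalized gradient does not depend on the defining function. *)
Definition normal {R : realType} {d : nat} (A : set 'rV[R]_d)
    (p : 'rV[R]_d) : 'rV[R]_d :=
  xget 0 [set n | exists2 phi, defining_function A p phi &
                  n = (enorm (grad phi p))^-1 *: grad phi p].

(* Boundary limit at p of a field defined on A. *)
Definition trace {R : realType} {d : nat} (A : set 'rV[R]_d)
    (h : 'rV[R]_d -> 'rV[R]_d) (p : 'rV[R]_d) : 'rV[R]_d :=
  lim (h x @[x --> within A (nbhs p)]).

(* Boundary limit from A of the traction on bdry Omega; the normal is frozen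
   at the boundary point. *)
Definition traction_trace {R : realType} {d : nat} (Omega A : set 'rV[R]_d)
    (sigma : 'rV[R]_d -> 'M[R]_d) (p : 'rV[R]_d) : 'rV[R]_d :=
  trace A (traction sigma (normal Omega p)) p.

(* u, with stress field sigma, solves the two-phase elasticity system in the
   open set E, with phase 1 in D and phase 2 in the rest of E. *)
Definition transmission_system {R : realType} {d : nat} (D E : set 'rV[R]_d)
    (lam1 lam2 mu : R) (u : 'rV[R]_d -> 'rV[R]_d)
    (sigma : 'rV[R]_d -> 'M[R]_d) : Prop :=
  [/\ [/\ smooth_on D u, smooth_on (E `\` closure D) u &
          {within closure E, continuous u}],
      (forall x, D x -> lame lam1 mu u x = 0),
      (forall x, (E `\` closure D) x -> lame lam2 mu u x = 0),
      (forall x, (E `\` bdry D) x -> sigma x = stress2 D lam1 lam2 mu u x) &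
      (forall p, bdry D p -> exists t : 'rV[R]_d,
          (traction sigma (normal D p) x
             @[x --> within D (nbhs p)] --> t) /\
          (traction sigma (normal D p) x
             @[x --> within (E `\` closure D) (nbhs p)] --> t))].

Definition decays_like {R : realType} {d : nat} (v : 'rV[R]_d -> 'rV[R]_d)
    (k : int) : Prop :=
  exists C M : R, forall x, M <= enorm x -> enorm (v x) <= C * enorm x ^ k.

Definition exterior_solution {R : realType} {d : nat} (Omega : set 'rV[R]_d)
    (lamE mu : R) (ut uE : 'rV[R]_d -> 'rV[R]_d) : Prop :=
  [/\ smooth_on (~` closure Omega) uE,
      (forall x, (~` closure Omega) x -> lame lamE mu uE x = 0),
      (forall p, bdry Omega p ->
         uE x @[x --> within (~` closure Omega) (nbhs p)] --> ut p) &
      (forall e : R, 0 < e -> exists M : R, forall x,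
         (~` closure Omega) x -> M <= enorm x -> enorm (uE x) < e)].

(* Graph of the exterior Dirichlet-to-Neumann map: only the values of ut and t
   on bdry Omega matter. *)
Definition DtN_graph {R : realType} {d : nat} (Omega : set 'rV[R]_d)
    (lamE mu : R) (ut t : 'rV[R]_d -> 'rV[R]_d) : Prop :=
  exists2 uE, exterior_solution Omega lamE mu ut uE &
    forall p, bdry Omega p ->
      traction (stress lamE mu uE) (normal Omega p) x
        @[x --> within (~` closure Omega) (nbhs p)] --> t p.

(* Lam is the exterior Dirichlet-to-Neumann map; its values are unconstrained
   on data for which the exterior problem has no solution with a traction. *)
Definition is_DtN_map {R : realType} {d : nat} (Omega : set 'rV[R]_d)
    (lamE mu : R)
    (Lam : ('rV[R]_d -> 'rV[R]_d) -> ('rV[R]_d -> 'rV[R]_d)) : Prop :=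
  forall ut t, DtN_graph Omega lamE mu ut t ->
    forall p, bdry Omega p -> Lam ut p = t p.

Definition Pbc {R : realType} {d : nat}
    (Lam : ('rV[R]_d -> 'rV[R]_d) -> ('rV[R]_d -> 'rV[R]_d))
    (v t f0 F0 : 'rV[R]_d -> 'rV[R]_d) (p : 'rV[R]_d) : 'rV[R]_d :=
  t p - Lam (v \- f0) p - F0 p.

(* Main.v *)
From HB Require Import structures.
Require Import Defs.
From mathcomp Require Import ring.

(** Outside [Omega] the field [u - f] is itself the solution of the exterior
    problem that defines the Dirichlet-to-Neumann map.

    The point is that [f = grad g] is in equilibrium for every choice of Lame
    moduli: [laplacian g] is the constant [Cg * d], the divergence of [grad g]
    is [laplacian g], and partial derivatives commute, so that
    [laplacian (grad g) = grad (laplacian g) = 0].  Both terms of the Lame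
    operator vanish ([lame_grad]).  Hence [u - f] solves the Lame system with
    moduli [lam2], [mu] off [closure Omega], it tends to 0 at infinity because
    [1 - d < 0], and on [bdry Omega] it equals [uI - f0].  Its traction is the
    exterior traction of [u] minus [F0], so the boundary condition
    [P(uI, sigmaI . n, f0, F0) = 0] says exactly that the tractions of [u] from
    the two sides of [bdry Omega] agree.

    They do agree ([traction_limit]).  At a boundary point off [closure D] the
    field [u] is smooth.  Since only [D `<=` Omega] is assumed, a boundary
    point [p] of [Omega] may also lie on [bdry D].  There the two boundaries are
    tangent and have the same outward normal ([normal_subset]), so that the
    transmission condition of [u] across [bdry D] at [p] is the required
    equality.

    The interior equations hold for [uI] because all the operators are local
    and [uI] coincides with [u] on the open sets concerned. *)

Set Implicit Arguments.
Unset Strict Implicit.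
Unset Printing Implicit Defensive.

Local Open Scope classical_set_scope.
Local Open Scope ring_scope.

(** * Smooth functions on open sets *)

Lemma near_eq_differentiable (R : realType) (V W : normedModType R)
    (f g : V -> W) (x : V) :
  (\forall y \near x, f y = g y) -> differentiable f x -> differentiable g x.
Proof.
move=> fg /diff_locallyP[dfc fE].
have gE : g \o shift x = cst (g x) + 'd f x +o_ 0 id.
  apply/eqaddoP => e e0.
  have /eqaddoP/(_ e e0) := fE.
  have fg0 : \forall h \near 0, f (h + x) = g (h + x).
    by have := fg; rewrite [X in X -> _](near_shift 0) /= subr0.
  apply: filterS2 fg0 => h fgh.
  by rewrite /= !fctE /= -fgh -(nbhs_singleton fg).
apply/diff_locallyP.
by rewrite (diff_unique dfc gE).
Qed.

Lemma near_open (T : topologicalType) (A P : set T) (x : T) :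
  open A -> (forall y, A y -> P y) -> A x -> \forall y \near x, P y.
Proof. by move=> Ao AP Ax; apply: filterS AP _; exact: open_nbhs_nbhs. Qed.

Lemma open_eq_derive (R : realType) (V W : normedModType R) (A : set V)
    (f g : V -> W) (v : V) :
  open A -> (forall x, A x -> f x = g x) ->
  forall x, A x -> 'D_v f x = 'D_v g x.
Proof.
move=> Ao fg x Ax; apply: near_eq_derive.
exact: near_open Ao fg Ax.
Qed.

Notation iter_derive h s := (foldr (fun v k => 'D_v k) h s).

Lemma open_eq_iter_derive (R : realType) (V W : normedModType R) (A : set V)
    (f g : V -> W) (s : seq V) :
  open A -> (forall x, A x -> f x = g x) ->
  forall x, A x -> iter_derive f s x = iter_derive g s x.
Proof. by move=> Ao fg; elim: s => //= v s IH; exact: open_eq_derive. Qed.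

Lemma open_eq_smooth_on (R : realType) (V W : normedModType R) (A : set V)
    (f g : V -> W) :
  open A -> (forall x, A x -> f x = g x) -> smooth_on A f -> smooth_on A g.
Proof.
move=> Ao fg fs s x Ax; apply: near_eq_differentiable (fs s x Ax).
exact: near_open Ao (open_eq_iter_derive s Ao fg) Ax.
Qed.

Lemma smooth_on_differentiable (R : realType) (V W : normedModType R)
    (A : set V) (h : V -> W) x : smooth_on A h -> A x -> differentiable h x.
Proof. by move=> /(_ [::] x). Qed.

Lemma smooth_on_derive (R : realType) (V W : normedModType R)
    (A : set V) (h : V -> W) v : smooth_on A h -> smooth_on A ('D_v h).
Proof.
by move=> hs s x Ax; have := hs (rcons s v) x Ax; rewrite foldr_rcons.
Qed.

Lemma smooth_on_subset (R : realType) (V W : normedModType R)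
    (A B : set V) (h : V -> W) : A `<=` B -> smooth_on B h -> smooth_on A h.
Proof. by move=> AB hs s x Ax; apply: hs; exact: AB. Qed.

(** Peels off the innermost derivative instead of the outermost one, which is
    the useful direction when the first derivatives of [h] are explicit. *)
Lemma smooth_onP (R : realType) (V W : normedModType R)
    (A : set V) (h : V -> W) :
  (forall x, A x -> differentiable h x) -> (forall v, smooth_on A ('D_v h)) ->
  smooth_on A h.
Proof.
move=> dh sh; elim/last_ind => [//|s v _] x Ax.
by rewrite foldr_rcons; exact: sh.
Qed.

Lemma smooth_on_cst (R : realType) (V W : normedModType R)
    (A : set V) (w : W) : smooth_on A (cst w : V -> W).
Proof.
move=> s x _.
suff [c ->] : exists c, iter_derive (cst w : V -> W) s = cst c by [].
elim: s => [|v s [c IH]] /=; first by exists w.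
by exists 0; rewrite IH; apply/funext => y; rewrite derive_cst.
Qed.

Lemma smooth_on_id (R : realType) (V : normedModType R)
    (A : set V) : smooth_on A (id : V -> V).
Proof.
apply: smooth_onP => // v.
rewrite (_ : 'D_v id = cst v); first exact: smooth_on_cst.
by apply/funext => x; rewrite derive_id.
Qed.

(** [A] must be open because 'D_v f x depends on [f] near [x]: the sum rule for
    the derivatives of order [n] on all of [A] gives it for order [n + 1]. *)
Lemma smooth_onD (R : realType) (V W : normedModType R)
    (A : set V) (f g : V -> W) :
  open A -> smooth_on A f -> smooth_on A g -> smooth_on A (f \+ g).
Proof.
move=> Ao fs gs s.
have E : forall x, A x ->
    (iter_derive f s \+ iter_derive g s) x = iter_derive (f \+ g) s x.
  elim: s => //= v s IH x Ax.
  rewrite -(open_eq_derive v Ao IH Ax) deriveD//; apply: diff_derivable.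
    exact: fs.
  exact: gs.
move=> x Ax.
apply: (@near_eq_differentiable _ _ _ (iter_derive f s \+ iter_derive g s)).
  exact: near_open Ao E Ax.
by apply: differentiableD; [exact: fs|exact: gs].
Qed.

(** Iterated derivatives commute with a continuous linear map. Coordinates,
    scalings and multiples of a fixed vector are all of this form. *)
Lemma smooth_on_linear (R : realType) (U V W : normedModType R) (A : set U)
    (L : V -> W) (h : U -> V) :
  open A -> linear L -> continuous L -> smooth_on A h -> smooth_on A (L \o h).
Proof.
move=> Ao Llin Lc hs s.
pose L' : {linear V -> W} := HB.pack L (GRing.isLinear.Build _ _ _ _ _ Llin).
have dL y : differentiable L y by exact: (@linear_differentiable _ _ _ L').
have DL k v x : differentiable k x -> 'D_v (L \o k) x = L ('D_v k x).
  move=> dk; rewrite deriveE; last exact: differentiable_comp.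
  by rewrite diff_comp //= (@diff_lin _ _ _ L')// deriveE.
have E : forall x, A x -> (L \o iter_derive h s) x = iter_derive (L \o h) s x.
  elim: s => //= v s IH x Ax.
  by rewrite -(open_eq_derive v Ao IH Ax) DL//; exact: hs.
move=> x Ax; apply: (@near_eq_differentiable _ _ _ (L \o iter_derive h s)).
  exact: near_open Ao E Ax.
by apply: differentiable_comp => //; exact: hs.
Qed.

Lemma smooth_on_sum (R : realType) (V W : normedModType R) (A : set V)
    (I : Type) (r : seq I) (F : I -> V -> W) :
  open A -> (forall i, smooth_on A (F i)) ->
  smooth_on A (fun x => \sum_(i <- r) F i x).
Proof.
move=> Ao Fs; elim: r => [|i r IH].
  by under eq_fun do rewrite big_nil; exact: smooth_on_cst.
by under eq_fun do rewrite big_cons; exact: smooth_onD.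
Qed.

Lemma smooth_onB (R : realType) (V W : normedModType R)
    (A : set V) (f g : V -> W) :
  open A -> smooth_on A f -> smooth_on A g -> smooth_on A (f \- g).
Proof.
move=> Ao fs gs; apply: (@smooth_onD _ _ _ A f (-%R \o g)) => //.
apply: (@smooth_on_linear _ _ _ _ A -%R g) => //; last exact: opp_continuous.
by move=> a x y; rewrite opprD scalerN.
Qed.

Lemma smooth_onZ (R : realType) (V W : normedModType R)
    (A : set V) (f : V -> W) (a : R) :
  open A -> smooth_on A f -> smooth_on A (fun x => a *: f x).
Proof.
move=> Ao fs; apply: (@smooth_on_linear _ _ _ _ A ( *:%R a) f) => //.
  by move=> b x y; rewrite scalerDr !scalerA mulrC.
exact: scaler_continuous.
Qed.

Lemma smooth_on_coord (R : realType) (V : normedModType R) (m n : nat)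
    (A : set V) (u : V -> 'M[R]_(m, n)) i j :
  open A -> smooth_on A u -> smooth_on A (fun x => u x i j).
Proof.
move=> Ao us.
apply: (@smooth_on_linear _ _ _ _ A (fun M : 'M[R]_(m, n) => M i j) u) => //.
  by move=> a M N; rewrite !mxE.
exact: coord_continuous.
Qed.

(** * Symmetry of second derivatives *)

Lemma is_derive_line (R : realType) (V : normedModType R) (h : V -> R)
    (x v : V) (t : R) :
  differentiable h (t *: v + x) ->
  is_derive t 1 (fun s => h (s *: v + x)) ('D_v h (t *: v + x)).
Proof.
move=> dh; pose l (s : R) : V := s *: v + x.
have [dl dlE] : is_diff t l (fun s => s *: v).
  rewrite (_ : (fun s : R => s *: v) = (fun s => s *: v) + cst 0).
    exact: is_diffD.
  by apply/funext => s /=; rewrite fctE addr0.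
have dhl : differentiable (h \o l) t by exact: differentiable_comp.
split; first exact: diff_derivable.
rewrite deriveE// -[X in 'd X t]/(h \o l) diff_comp//.
by rewrite /= dlE scale1r deriveE.
Qed.

Lemma MVT_line (R : realType) (V : normedModType R) (h : V -> R) (x v : V)
    (t : R) :
  (forall y, differentiable h y) -> 0 < t ->
  exists2 c, 0 < c < t & h (t *: v + x) - h x = 'D_v h (c *: v + x) * t.
Proof.
move=> dh t0.
have D s := @is_derive_line _ _ h x v s (dh _).
have [|c ct] := MVT t0 (fun s _ => D s).
  apply: continuous_subspaceT => s; apply: differentiable_continuous.
  by apply/derivable1_diffP; have [] := D s.
by rewrite scale0r add0r subr0 => E; exists c; rewrite // -in_itv.
Qed.

(** The mean value theorem is applied twice: along [v] to the difference of [h]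
    and its translate by [t *: w], and then along [w] to 'D_v h. The left side
    is symmetric in [v] and [w]. *)
Lemma second_difference (R : realType) (V : normedModType R) (h : V -> R)
    (x v w : V) (t : R) :
  smooth_on setT h -> 0 < t ->
  exists c c', [/\ 0 < c < t, 0 < c' < t &
    (h (t *: v + (t *: w + x)) - h (t *: w + x)) - (h (t *: v + x) - h x)
    = 'D_w ('D_v h) (c' *: w + (c *: v + x)) * t * t].
Proof.
move=> hs t0.
have dh y : differentiable h y := smooth_on_differentiable hs I.
pose sh z := t *: w + z.
have dsh y : is_diff y sh id.
  rewrite (_ : id = cst 0 + id); first exact: is_diffD.
  by apply/funext => z; rewrite fctE /= add0r.
have dsh' y : differentiable sh y by have [] := dsh y.
have dhs y : differentiable (h \o sh) y by exact: differentiable_comp.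
pose k := (h \o sh) \- h.
have dk y : differentiable k y by apply: differentiableB.
have [c ct Ec] := MVT_line x v dk t0.
have Dv y : differentiable ('D_v h) y.
  exact: smooth_on_differentiable (smooth_on_derive v hs) I.
have [c' ct' Ec'] := MVT_line (c *: v + x) w Dv t0.
exists c, c'; split=> //; rewrite -Ec'.
transitivity (k (t *: v + x) - k x).
  by rewrite /k /= addrCA; ring.
rewrite Ec; congr (_ * _); rewrite /k deriveB; last 2 first.
- exact: diff_derivable.
- exact: diff_derivable.
congr (_ - _); rewrite deriveE// diff_comp//.
by have [_ dshE] := dsh (c *: v + x); rewrite /= dshE deriveE.
Qed.

(** Schwarz's theorem. Evaluating the second difference at scale [t] in both
    orders gives points near [x] where the two mixed derivatives take a common
    value; both are continuous at [x]. *)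
Lemma derive_comm (R : realType) (V : normedModType R) (h : V -> R)
    (v w x : V) :
  smooth_on setT h -> 'D_v ('D_w h) x = 'D_w ('D_v h) x.
Proof.
move=> hs.
have cont a b : {for x, continuous ('D_a ('D_b h))}.
  apply: differentiable_continuous.
  exact: smooth_on_differentiable (smooth_on_derive a (smooth_on_derive b hs)) I.
apply/eqP; rewrite -subr_eq0 -normr_le0.
apply/ler_addgt0Pr => e e0; rewrite add0r.
have e2 : 0 < e / 2 by rewrite divr_gt0.
have /cvgrPdist_lt/(_ _ e2) /nbhs_ballP[r1 r10 B1] := cont v w.
have /cvgrPdist_lt/(_ _ e2) /nbhs_ballP[r2 r20 B2] := cont w v.
(* At this scale all the intermediate points lie in both balls; the summand 1
   covers the case v = w = 0. *)
pose t := Num.min r1 r2 / (`|v| + `|w| + 1).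
have n0 : 0 < `|v| + `|w| + 1 by rewrite ltr_wpDl// addr_ge0.
have t0 : 0 < t by rewrite divr_gt0// lt_min r10.
have small a b c d : 0 < c < t -> 0 < d < t -> `|a| + `|b| = `|v| + `|w| ->
    `|x - (c *: a + (d *: b + x))| < Num.min r1 r2.
  move=> /andP[c0 ct] /andP[d0 dt] ab.
  rewrite addrA opprD addrCA subrr addr0 normrN.
  apply: le_lt_trans (ler_normD _ _) _; rewrite !normrZ !gtr0_norm//.
  apply: (@le_lt_trans _ _ (t * (`|v| + `|w|))).
    by rewrite -ab mulrDr lerD// ler_wpM2r// ltW.
  by rewrite /t mulrAC ltr_pdivrMr// ltr_pM2l ?ltrDl// lt_min r10.
clearbody t; have [c [c' [ct ct' E1]]] := second_difference x v w hs t0.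
have [d [d' [dt dt' E2]]] := second_difference x w v hs t0.
have E : 'D_v ('D_w h) (d' *: v + (d *: w + x)) =
         'D_w ('D_v h) (c' *: w + (c *: v + x)).
  have tt : t * t != 0 by rewrite mulf_neq0// gt_eqF.
  apply: (mulIf tt); rewrite /= !mulrA -E1 -E2.
  by rewrite [t *: v + (_ + _)]addrCA; ring.
have /= N1 := B1 (d' *: v + (d *: w + x)) _.
have /= N2 := B2 (c' *: w + (c *: v + x)) _.
rewrite -E in N2.
have /N1 {}N1 : ball x r1 (d' *: v + (d *: w + x)).
  rewrite -ball_normE /=; apply: lt_le_trans (small _ _ _ _ dt' dt erefl) _.
  by rewrite ge_min lexx.
have /N2 {}N2 : ball x r2 (c' *: w + (c *: v + x)).
  rewrite -ball_normE /=; apply: lt_le_trans (small _ _ _ _ ct' ct _) _.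
    by rewrite addrC.
  by rewrite ge_min lexx orbT.
apply: ltW; rewrite (splitr e).
apply: le_lt_trans (ltrD N1 N2); rewrite [X in _ <= _ + X]distrC.
exact: ler_distD.
Qed.

(** * Limits along restricted neighbourhoods *)

Lemma near_eq_cvg_to (S T : topologicalType) (F : set_system S) (FF : Filter F)
    (h k : S -> T) (l : T) :
  (\forall x \near F, h x = k x) -> h x @[x --> F] --> l -> k x @[x --> F] --> l.
Proof.
move=> hk hl B /hl Bh; rewrite /nbhs /=.
by apply: (@filterS2 _ F _ _ _ (k @^-1` B) _ hk Bh) => x /= ->.
Qed.

Lemma cvg_within_subset (S T : topologicalType) (A B : set S) (p : S)
    (h : S -> T) (l : T) :
  A `<=` B -> h x @[x --> within B (nbhs p)] --> l ->
  h x @[x --> within A (nbhs p)] --> l.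
Proof.
by move=> AB hl; apply: cvg_trans hl; apply: cvg_fmap2; exact: within_subset.
Qed.

Lemma cvg_withinU (S T : topologicalType) (A B : set S) (p : S)
    (h : S -> T) (l : T) :
  h x @[x --> within A (nbhs p)] --> l -> h x @[x --> within B (nbhs p)] --> l ->
  h x @[x --> within (A `|` B) (nbhs p)] --> l.
Proof.
move=> hA hB N Nl; have := hA N Nl; have := hB N Nl.
rewrite /nbhs /= /within /=; apply: filterS2 => x NB NA [/NA|/NB]//.
Qed.

Lemma setD_bdry_sub (T : topologicalType) (D E : set T) :
  E `\` bdry D `<=` D `|` (E `\` closure D).
Proof.
move=> x [Ex nb]; have [Dx|nD] := pselect (D x); [by left|right; split=> // cD].
by apply: nb; split=> // /interior_subset.
Qed.

(** * The Lame and stress operators *)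

Section Elasticity.
Variables (R : realType) (d : nat).
Local Notation V := 'rV[R]_d.
Implicit Types (A : set V) (g h : V -> R) (u v : V -> V).

Lemma smooth_on_partial (W : normedModType R) A (h : V -> W) i :
  smooth_on A h -> smooth_on A (partial i h).
Proof. exact: smooth_on_derive. Qed.

Lemma partial_coord A u i k x : smooth_on A u -> A x ->
  partial i (fun y => u y 0 k) x = partial i u x 0 k.
Proof.
move=> us Ax; rewrite /partial derive_mx ?mxE//.
by apply: diff_derivable; exact: smooth_on_differentiable us Ax.
Qed.

Lemma smooth_on_grad A g : open A -> smooth_on A g -> smooth_on A (grad g).
Proof.
move=> Ao gs.
rewrite (_ : grad g = fun x => \sum_i partial i g x *: delta_mx 0 i); last first.
  apply/funext => x; rewrite [LHS]row_sum_delta.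
  by apply: eq_bigr => i _; rewrite mxE.
apply: smooth_on_sum => // i.
apply: (@smooth_on_linear R V R V A (fun a => a *: delta_mx 0 i)
  (partial i g)) => //.
- by move=> b x y; rewrite scalerDl scalerA.
- exact: scalel_continuous.
- exact: smooth_on_partial.
Qed.

Lemma smooth_on_divg A u : open A -> smooth_on A u -> smooth_on A (divg u).
Proof.
move=> Ao us; apply: smooth_on_sum => // i.
by apply: smooth_on_coord => //; exact: smooth_on_partial.
Qed.

Section Locality.
Variables (A : set V) (Ao : open A).

Lemma open_eq_grad g h : (forall x, A x -> g x = h x) ->
  forall x, A x -> grad g x = grad h x.
Proof.
by move=> E x Ax; apply/rowP => i; rewrite !mxE; exact: (open_eq_derive _ Ao E).
Qed.

Lemma open_eq_divg u v : (forall x, A x -> u x = v x) ->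
  forall x, A x -> divg u x = divg v x.
Proof.
move=> E x Ax; apply: eq_bigr => i _; congr (fun_of_matrix _ _ _).
exact: (open_eq_derive _ Ao E).
Qed.

Lemma open_eq_laplacian (W : normedModType R) (g h : V -> W) :
  (forall x, A x -> g x = h x) ->
  forall x, A x -> laplacian g x = laplacian h x.
Proof.
move=> E x Ax; apply: eq_bigr => i _.
by apply: (open_eq_derive _ Ao) => // y Ay; exact: (open_eq_derive _ Ao E).
Qed.

Lemma open_eq_lame lam mu u v : (forall x, A x -> u x = v x) ->
  forall x, A x -> lame lam mu u x = lame lam mu v x.
Proof.
move=> E x Ax.
have lE : laplacian u x = laplacian v x by exact: open_eq_laplacian E x Ax.
have gE : grad (divg u) x = grad (divg v) x.
  exact: open_eq_grad (open_eq_divg E) x Ax.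
by rewrite /lame lE gE.
Qed.

Lemma open_eq_stress lam mu u v : (forall x, A x -> u x = v x) ->
  forall x, A x -> stress lam mu u x = stress lam mu v x.
Proof.
move=> E x Ax.
have dE : divg u x = divg v x by exact: open_eq_divg E x Ax.
have gE : gradm u x = gradm v x.
  apply/matrixP => i j; rewrite !mxE; congr (fun_of_matrix _ _ _).
  exact: (open_eq_derive _ Ao E).
by rewrite /stress dE gE.
Qed.

Lemma partialB (W : normedModType R) (f h : V -> W) i :
  smooth_on A f -> smooth_on A h ->
  forall x, A x -> partial i (f \- h) x = partial i f x - partial i h x.
Proof.
move=> fs hs x Ax; rewrite /partial deriveB//; apply: diff_derivable.
  exact: smooth_on_differentiable fs Ax.
exact: smooth_on_differentiable hs Ax.
Qed.

Lemma gradB g h : smooth_on A g -> smooth_on A h ->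
  forall x, A x -> grad (g \- h) x = grad g x - grad h x.
Proof.
by move=> gs hs x Ax; apply/rowP => i; rewrite !mxE partialB.
Qed.

Lemma divgB u v : smooth_on A u -> smooth_on A v ->
  forall x, A x -> divg (u \- v) x = (divg u \- divg v) x.
Proof.
move=> us vs x Ax; rewrite /= -sumrB; apply: eq_bigr => i _.
by rewrite partialB// !mxE.
Qed.

Lemma laplacianB (W : normedModType R) (f h : V -> W) :
  smooth_on A f -> smooth_on A h ->
  forall x, A x -> laplacian (f \- h) x = laplacian f x - laplacian h x.
Proof.
move=> fs hs x Ax; rewrite -sumrB; apply: eq_bigr => i _.
rewrite -partialB//; try exact: smooth_on_partial.
by apply: (open_eq_derive _ Ao) => // y Ay; rewrite partialB.
Qed.

Lemma lameB lam mu u v : smooth_on A u -> smooth_on A v ->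
  forall x, A x -> lame lam mu (u \- v) x = lame lam mu u x - lame lam mu v x.
Proof.
move=> us vs x Ax.
have lB := laplacianB us vs Ax.
have gB := open_eq_grad (divgB us vs) Ax.
rewrite gradB in gB => //; try exact: smooth_on_divg.
rewrite /lame lB gB.
rewrite !scalerBr !opprB opprK [X in X + _ = _]addrC.
by rewrite [X in _ + X = _]addrC addrACA; congr (_ + _); rewrite addrC.
Qed.

Lemma stressB lam mu u v : smooth_on A u -> smooth_on A v ->
  forall x, A x ->
  stress lam mu (u \- v) x = stress lam mu u x - stress lam mu v x.
Proof.
move=> us vs x Ax.
have dB := divgB us vs Ax.
have gB : gradm (u \- v) x = gradm u x - gradm v x.
  apply/matrixP => i j; have pB := partialB j us vs Ax.
  by rewrite [LHS]mxE pB !mxE.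
rewrite /stress dB gB /=.
rewrite mulrBr (raddfB (@scalar_mx R d)) /= (linearB (@trmx R d d)) /=.
by rewrite (addrACA (gradm u x)) -opprD scalerBr addrACA -opprD.
Qed.

End Locality.

(** * Gradients in equilibrium *)

Lemma grad_cst (c : R) x : grad (cst c : V -> R) x = 0.
Proof. by apply/rowP => i; rewrite !mxE /partial derive_cst. Qed.

Lemma partial_grad g i : smooth_on setT g ->
  partial i (grad g) = grad (partial i g).
Proof.
move=> gs; apply/funext => x; apply/rowP => k; rewrite mxE.
have gd := smooth_on_grad openT gs.
have gk : (fun y => grad g y 0 k) = partial k g by apply/funext => y; rewrite mxE.
by rewrite -(partial_coord i k gd I) gk; exact: derive_comm.
Qed.

(** [divg (grad g)] is [laplacian g], and [laplacian (grad g)] is [grad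
    (laplacian g)] by [derive_comm]; both terms of the Lame operator are
    therefore gradients of constants. *)
Lemma lame_grad lam mu g (c : R) : smooth_on setT g ->
  (forall x, laplacian g x = c) -> forall x, lame lam mu (grad g) x = 0.
Proof.
move=> gs gc x.
have divE : divg (grad g) = cst c.
  apply/funext => y; rewrite /= -(gc y); apply: eq_bigr => i _.
  by rewrite partial_grad// mxE.
rewrite /lame divE grad_cst scaler0 oppr0 add0r.
suff -> : laplacian (grad g) x = 0 by rewrite scaler0 oppr0.
have gcE : laplacian g = cst c by exact/funext.
have gd i : smooth_on setT (partial i (partial i g)).
  by do 2!apply: smooth_on_partial.
have lapE : laplacian g = \sum_i partial i (partial i g).
  by apply/funext => y; rewrite fct_sumE.
rewrite -(grad_cst c x) -gcE lapE; apply/rowP => k.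
rewrite mxE summxE [RHS]derive_sum => [|i]; last first.
  by apply: diff_derivable; exact: smooth_on_differentiable (gd i) I.
apply: eq_bigr => i _.
have -> : partial i (partial i (grad g)) = grad (partial i (partial i g)).
  by rewrite !partial_grad//; exact: smooth_on_partial.
by rewrite mxE.
Qed.

(** * The Euclidean inner product *)

Implicit Types (D O : set V) (phi : V -> R) (p n x a b w : V).

Lemma dotvC a b : dotv a b = dotv b a.
Proof. by apply: eq_bigr => i _; rewrite mulrC. Qed.

Lemma dotvDl a b w : dotv (a + b) w = dotv a w + dotv b w.
Proof. by rewrite -big_split; apply: eq_bigr => i _; rewrite mxE mulrDl. Qed.

Lemma dotvZl (c : R) a b : dotv (c *: a) b = c * dotv a b.
Proof. by rewrite mulr_sumr; apply: eq_bigr => i _; rewrite mxE mulrA. Qed.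

Lemma dotvDr a b w : dotv w (a + b) = dotv w a + dotv w b.
Proof. by rewrite dotvC dotvDl !(dotvC w). Qed.

Lemma dotvZr (c : R) a b : dotv a (c *: b) = c * dotv a b.
Proof. by rewrite dotvC dotvZl dotvC. Qed.

Lemma dotv_ge0 a : 0 <= dotv a a.
Proof. by apply: sumr_ge0 => i _; rewrite -expr2 sqr_ge0. Qed.

Lemma dotv_eq0 a : (dotv a a == 0) = (a == 0).
Proof.
apply/eqP/eqP => [a0|->]; last by apply: big1 => i _; rewrite mxE mul0r.
apply/rowP => i; rewrite mxE; apply/eqP; rewrite -[_ == 0]orbb -mulf_eq0.
apply/eqP; move: i (erefl true); apply/psumr_eq0P => // i _.
by rewrite -expr2 sqr_ge0.
Qed.

Lemma dotv_gt0 a : a != 0 -> 0 < dotv a a.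
Proof. by move=> a0; rewrite lt0r dotv_eq0 a0 dotv_ge0. Qed.

Lemma enormZ (c : R) a : 0 <= c -> enorm (c *: a) = c * enorm a.
Proof.
move=> c0; rewrite /enorm dotvZl dotvZr mulrA -expr2 sqrtrM ?sqr_ge0//.
by rewrite sqrtr_sqr ger0_norm.
Qed.

(** * The quadratic part of the potential *)

Definition quad (c : R) x := c * dotv x x.

Lemma derive_coord k w x : 'D_w (fun y : V => y 0 k) x = w 0 k.
Proof.
have H : 'D_w (id : V -> V) x = \matrix_(i, j) 'D_w (fun y : V => y i j) x.
  by apply: derive_mx; exact: derivable_id.
by rewrite derive_id in H; rewrite [in RHS]H mxE.
Qed.

(** The right side is a linear combination of coordinates, hence visibly smooth
    in [x]. *)
Lemma derive_quad (c : R) w x : 'D_w (quad c) x = \sum_i (2 * c * w 0 i) *: x 0 i.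
Proof.
have cd i : differentiable (fun y : V => y 0 i) x by exact: differentiable_coord.
have sd i : derivable ((fun y : V => y 0 i) * (fun y : V => y 0 i)) x w.
  by apply: diff_derivable; exact: differentiableM.
pose S : V -> R := \sum_i ((fun y : V => y 0 i) * (fun y : V => y 0 i)).
have SE : quad c = fun y => c *: S y.
  by apply/funext => y; rewrite /quad /dotv /S fct_sumE.
have D i : 'D_w ((fun y : V => y 0 i) * (fun y : V => y 0 i)) x =
    2 * w 0 i * x 0 i.
  rewrite deriveM; try exact: diff_derivable.
  by rewrite derive_coord /GRing.scale /=; ring.
have dS : derivable S x w by exact: derivable_sum.
have Z : 'D_w (fun y => c *: S y) x = c *: 'D_w S x by exact: deriveZ.
rewrite SE Z /S derive_sum// scaler_sumr; apply: eq_bigr => i _.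
by rewrite D /GRing.scale /=; ring.
Qed.

Lemma smooth_on_quad (c : R) : smooth_on setT (quad c).
Proof.
apply: smooth_onP => [x _|w].
  apply: (@differentiableZ R V R (fun x => dotv x x) c x).
  rewrite (_ : (fun x => dotv x x) =
      \sum_i ((fun y : V => y 0 i) * (fun y : V => y 0 i))).
    apply: differentiable_sum => i.
    by apply: differentiableM; exact: differentiable_coord.
  by apply/funext => y; rewrite fct_sumE.
rewrite (_ : 'D_w (quad c) = fun x => \sum_i (2 * c * w 0 i) *: x 0 i).
  apply: smooth_on_sum => [|i]; first exact: openT.
  apply: smooth_onZ; first exact: openT.
  by apply: (@smooth_on_coord R V 1 d setT id); [exact: openT|exact: smooth_on_id].
by apply/funext => x; exact: derive_quad.
Qed.

Lemma laplacian_quad (c : R) x : laplacian (quad c) x = 2 * c * d%:R.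
Proof.
rewrite /laplacian.
have P i : partial i (quad c) = (2 * c) \*: (fun y : V => y 0 i).
  apply/funext => y; rewrite /partial derive_quad (bigD1 i)//= big1 => [|j ji].
    by rewrite mxE !eqxx mulr1 addr0.
  by rewrite mxE (negbTE ji) andbF mulr0 scale0r.
rewrite (eq_bigr (fun=> 2 * c)) => [|i _].
  by rewrite sumr_const card_ord mulr_natr.
have dc : derivable (fun y : V => y 0 i) x (delta_mx 0 i).
  by apply: diff_derivable; exact: differentiable_coord.
have Z : partial i ((2 * c) \*: (fun y : V => y 0 i)) x =
    (2 * c) *: partial i (fun y : V => y 0 i) x by exact: deriveZ.
by rewrite P Z /partial derive_coord mxE !eqxx /GRing.scale /= mulr1.
Qed.

(** * Boundaries and outward normals *)

Lemma bdry_notin (T : topologicalType) (B : set T) q : open B -> bdry B q -> ~ B q.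
Proof. by move=> Bo [_ nB] Bq; apply: nB; rewrite /interior; exact: open_nbhs_nbhs. Qed.

Lemma notin_bdry (T : topologicalType) (B : set T) q :
  open B -> ~ B q -> closure B q -> bdry B q.
Proof. by move=> Bo nB cB; split => // /interior_subset. Qed.

Lemma derive_grad phi p w : differentiable phi p -> 'D_w phi p = dotv (grad phi p) w.
Proof.
move=> dphi; rewrite deriveE// {1}(row_sum_delta w) linear_sum.
by apply: eq_bigr => i _; rewrite linearZ /= mxE /partial deriveE// mulrC.
Qed.

Lemma defining_function_diff A p phi : defining_function A p phi -> differentiable phi p.
Proof. by move=> [U [[_ Up] Us _ _]]; exact: smooth_on_differentiable Us Up. Qed.

(** [phi p < 0] would put [p] in [A], and [phi p > 0] would keep [A] away from
    [p]. *)
Lemma defining_function_bdry A p phi : open A -> bdry A p ->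
  defining_function A p phi -> phi p = 0.
Proof.
move=> Ao bA df; have [U [[Uo Up] Us _ UA]] := df.
have nA := bdry_notin Ao bA; apply: le_anti; apply/andP; split; last first.
  by rewrite leNgt; apply/negP => /(UA _ Up).
rewrite leNgt; apply/negP => p0.
have cphi := differentiable_continuous (defining_function_diff df).
have [z [Az [Uz z0]]] : A `&` (U `&` [set z | 0 < phi z]) !=set0.
  have [+ _] := bA; apply; apply: filterI; first exact: open_nbhs_nbhs.
  exact: (cvgr_gt (phi p) cphi).
by move: (Az) => /(UA _ Uz); rewrite ltNge ltW.
Qed.

Lemma near_line p w (P : set V) : (\forall x \near p, P x) ->
  \forall t \near (0 : R)^'+, P (t *: w + p).
Proof.
move=> pP; apply: cvg_within.
have c : t *: w + p @[t --> (0 : R)] --> 0 *: w + p.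
  by apply: cvgD; [exact: scalel_continuous|exact: cvg_cst].
by rewrite scale0r add0r in c; exact: c.
Qed.

Lemma near_derive_gt0 phi p w : derivable phi p w -> 0 < 'D_w phi p ->
  \forall t \near (0 : R)^'+, phi p < phi (t *: w + p).
Proof.
move=> dphi D0.
have /cvgr_gt/(_ 0 D0) :
    t^-1 *: (phi (t *: w + p) - phi p) @[t --> (0:R)^'] --> 'D_w phi p.
  exact: dphi.
move=> H; have {}H : \forall t \near (0 : R)^'+,
    0 < t^-1 *: (phi (t *: w + p) - phi p).
  move: H; rewrite !near_withinE; apply: filterS => t Ht t0; apply: Ht.
  by rewrite gt_eqF.
near=> t; have t0 : 0 < t by near: t; exact: nbhs_right_gt.
rewrite -subr_gt0 -(pmulr_rgt0 _ (_ : 0 < t^-1)) ?invr_gt0//.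
by near: t.
Unshelve. all: by end_near. Qed.

(** If the open half-space [dotv a w < 0] lies in the closed half-space [dotv b
    w <= 0], then [a] and [b] point in the same direction. Let [w] be the
    component of [b] orthogonal to [a]. Testing with [w - e *: a] for small [e
    > 0] gives [dotv b w <= 0] in the limit, while [dotv b w = dotv w w]; so [w
    = 0]. Testing with [- a] gives the sign. *)
Lemma halfspace_incl a b : a != 0 -> b != 0 ->
  (forall w, dotv a w < 0 -> dotv b w <= 0) ->
  (enorm a)^-1 *: a = (enorm b)^-1 *: b.
Proof.
move=> a0 b0 H.
have aa := dotv_gt0 a0; set s := dotv a a in aa.
set m := dotv b a; set c := m / s.
have m0 : 0 <= m.
  have := H ((-1) *: a); rewrite !dotvZr -/s -/m !mulN1r oppr_lt0 oppr_le0.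
  exact.
have c0 : 0 <= c by rewrite divr_ge0// ltW.
have [w wE] : exists w, w = b + (- c) *: a by eexists.
have aw : dotv a w = 0.
  by rewrite wE dotvDr dotvZr -/s dotvC -/m /c; field; rewrite gt_eqF.
have bw : dotv b w = dotv w w.
  by rewrite [X in _ = dotv X _]wE dotvDl dotvZl aw mulr0 addr0.
have w0 : w = 0.
  apply/eqP; rewrite -dotv_eq0 eq_le dotv_ge0 andbT.
  apply/ler_addgt0Pr => e e0; rewrite add0r.
  have m1 : 0 < m + 1 by rewrite ltr_wpDl.
  (* This coefficient makes the error term at most e; m may vanish. *)
  have := H (w + (- (e / (m + 1))) *: a).
  rewrite !dotvDr !dotvZr aw bw -/s -/m add0r mulNr oppr_lt0 mulr_gt0 ?divr_gt0//.
  move=> /(_ isT); rewrite mulNr subr_le0 => /le_trans; apply.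
  by rewrite mulrAC ler_pdivrMr// ler_pM2l// lerDl.
have bE : b = c *: a by apply/eqP; rewrite -subr_eq0 -scaleNr -wE w0.
have cn0 : c != 0 by apply: contraNneq b0 => c00; rewrite bE c00 scale0r.
by rewrite bE enormZ// scalerA invfM mulrAC mulVf// mul1r.
Qed.

Lemma normalP A p : smooth_boundary A -> bdry A p ->
  exists2 phi, defining_function A p phi &
    normal A p = (enorm (grad phi p))^-1 *: grad phi p.
Proof.
move=> As /As[phi dphi].
have : exists n, [set n | exists2 phi, defining_function A p phi &
                  n = (enorm (grad phi p))^-1 *: grad phi p] n.
  by exists ((enorm (grad phi p))^-1 *: grad phi p), phi.
by move=> /(@xgetPex _ 0).
Qed.

(** Moving from [p] along a direction that decreases the defining function of
    [D] enters [D], hence [O]; so that direction does not increase the defining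
    function of [O], and [halfspace_incl] applies to the two gradients. *)
Lemma normal_subset D O p : open D -> open O -> smooth_boundary D ->
  smooth_boundary O -> D `<=` O -> bdry D p -> bdry O p ->
  normal D p = normal O p.
Proof.
move=> Do Oo Ds Os DO bD bO.
have [phi fphi ->] := normalP Ds bD; have [psi fpsi ->] := normalP Os bO.
have phi0 := defining_function_bdry Do bD fphi.
have psi0 := defining_function_bdry Oo bO fpsi.
have dphi := defining_function_diff fphi.
have dpsi := defining_function_diff fpsi.
have [U [[Uo Up] _ phin UD]] := fphi; have [W [[Wo Wp] _ psin WO]] := fpsi.
apply: halfspace_incl => // w; rewrite -!derive_grad// => wphi.
rewrite leNgt; apply/negP => wpsi.
have dN : 'D_w (- phi) p = - 'D_w phi p by apply: deriveN; exact: diff_derivable.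
have wphi' : 0 < 'D_w (- phi) p by rewrite dN oppr_gt0.
have dvphi : derivable (- phi) p w.
  by apply: diff_derivable; exact: differentiableN.
have dvpsi : derivable psi p w by exact: diff_derivable.
have N1 := near_derive_gt0 dvphi wphi'.
have N2 := near_derive_gt0 dvpsi wpsi.
have N3 := near_line w (open_nbhs_nbhs (conj Uo Up)).
have N4 := near_line w (open_nbhs_nbhs (conj Wo Wp)).
near (0 : R)^'+ => t.
have Ut : U (t *: w + p) by near: t.
have Wt : W (t *: w + p) by near: t.
have : D (t *: w + p).
  apply/(UD _ Ut); have : (- phi) p < (- phi) (t *: w + p) by near: t.
  by rewrite !fctE phi0 oppr0 oppr_gt0.
move=> /DO /(WO _ Wt); apply/negP; rewrite -leNgt ltW// -psi0.
by near: t.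
Unshelve. all: by end_near. Qed.

(** Along the gradient of a defining function one leaves [closure O], because
    the set where that function is positive is a neighbourhood that misses [O].
    Limits at [p] from outside [closure O] are therefore unique. *)
Lemma bdry_closure_ext O p : open O -> smooth_boundary O -> bdry O p ->
  closure (~` closure O) p.
Proof.
move=> Oo Os bO B Bp.
have [phi fphi _] := normalP Os bO.
have phi0 := defining_function_bdry Oo bO fphi.
have dphi := defining_function_diff fphi.
have [U [[Uo Up] Us phin UO]] := fphi.
pose w := grad phi p.
have D0 : 0 < 'D_w phi p by rewrite derive_grad// dotv_gt0.
have dvphi : derivable phi p w by exact: diff_derivable.
have N1 := near_derive_gt0 dvphi D0.
have N2 := near_line w (open_nbhs_nbhs (conj Uo Up)).
have N3 := near_line w Bp.
near (0 : R)^'+ => t; exists (t *: w + p); split; last by near: t.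
have Ut : U (t *: w + p) by near: t.
have pt : 0 < phi (t *: w + p) by rewrite -phi0; near: t.
have cphi := differentiable_continuous (smooth_on_differentiable Us Ut).
move=> clO; have [z [Oz [Uz z0]]] : O `&` (U `&` [set z | 0 < phi z]) !=set0.
  apply: clO; apply: filterI; first exact: open_nbhs_nbhs.
  exact: (cvgr_gt _ cphi).
by move: Oz => /(UO _ Uz); rewrite ltNge ltW.
Unshelve. all: by end_near. Qed.

(** The boundary of an open set has no interior, so removing it from [E] does
    not change the adherent points. *)
Lemma closure_setD_bdry (T : topologicalType) (B E : set T) q :
  open B -> open E -> closure E q -> closure (E `\` bdry B) q.
Proof.
move=> Bo Eo cE N Nq.
have [y [Ey Ny]] := cE _ (nbhs_interior Nq).
have [bBy|nby] := pselect (bdry B y); last first.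
  by exists y; split=> //; exact: interior_subset.
have yEN : nbhs y (E `&` N).
  by apply: filterI => //; exact: open_nbhs_nbhs.
have [z [Bz [Ez Nz]]] := bBy.1 _ yEN.
by exists z; split=> //; split=> // /(bdry_notin Bo).
Qed.

(** * Boundary limits of tractions *)

Lemma cvg_mx (T : Type) (F : set_system T) (FF : Filter F) (m k : nat)
    (M : T -> 'M[R]_(m, k)) (l : 'M[R]_(m, k)) :
  (forall i j, M t i j @[t --> F] --> l i j) -> M t @[t --> F] --> l.
Proof.
move=> H B [P lP PB].
have : F [set t | forall ij : 'I_m * 'I_k, P ij.1 ij.2 (M t ij.1 ij.2)].
  by apply: filter_forall => -[i j]; exact: H (lP i j).
apply: (@filterS _ F _ _ (M @^-1` B)) => t Pt.
by apply: PB => i j; exact: (Pt (i, j)).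
Qed.

Lemma smooth_on_stress A lam mu u i j : open A -> smooth_on A u ->
  smooth_on A (fun x => stress lam mu u x i j).
Proof.
move=> Ao us.
pose G k l x := partial l u x 0 k.
have Gs k l : smooth_on A (G k l).
  by apply: smooth_on_coord => //; exact: smooth_on_partial.
rewrite (_ : (fun x => _) =
    (fun x => (lam *+ (i == j)) *: divg u x) \+
    (fun x => mu *: (G i j \+ G j i) x)).
  apply: smooth_onD => //; apply: smooth_onZ => //; first exact: smooth_on_divg.
  exact: smooth_onD.
apply/funext => x; rewrite /stress /gradm !mxE /G /=; congr (_ + _).
by rewrite /GRing.scale /= mulrnAl.
Qed.

(** Every entry of the stress is a combination of first derivatives of [u]. *)
Lemma traction_continuous A lam mu u n x : open A -> smooth_on A u -> A x ->
  {for x, continuous (traction (stress lam mu u) n)}.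
Proof.
move=> Ao us Ax; apply: (@cvg_mx _ (nbhs x) _) => i j.
pose h y := \sum_k n 0 k *: stress lam mu u y j k.
have hE y : traction (stress lam mu u) n y i j = h y.
  by rewrite ord1 /traction mxE; apply: eq_bigr => k _; rewrite mxE.
suff : {for x, continuous (fun y => traction (stress lam mu u) n y i j)} by [].
rewrite (funext hE).
apply: differentiable_continuous; apply: (@smooth_on_differentiable _ _ _ A) => //.
apply: smooth_on_sum => // k; apply: smooth_onZ => //.
exact: smooth_on_stress.
Qed.

Lemma tractionB lam mu A u v n x :
  open A -> smooth_on A u -> smooth_on A v -> A x ->
  traction (stress lam mu (u \- v)) n x =
  traction (stress lam mu u) n x - traction (stress lam mu v) n x.
Proof.
move=> Ao us vs Ax; have E := stressB lam mu us vs Ax.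
by rewrite /traction E linearB /= mulmxBr.
Qed.

Lemma trace_eq A u p l : closure A p ->
  u x @[x --> within A (nbhs p)] --> l -> trace A u p = l.
Proof.
move=> cA ul; have ? := within_nbhs_proper cA.
exact: cvg_lim.
Qed.

Lemma stress2_in D lam1 lam2 mu u x :
  D x -> stress2 D lam1 lam2 mu u x = stress lam1 mu u x.
Proof. by move=> Dx; rewrite /stress2 mem_set. Qed.

Lemma stress2_notin D lam1 lam2 mu u x :
  ~ D x -> stress2 D lam1 lam2 mu u x = stress lam2 mu u x.
Proof. by move=> Dx; rewrite /stress2 memNset. Qed.

(** Each condition is local, on [D] or on [O `\` closure D], where [u] and its
    restriction to [closure O] coincide, or a limit along a smaller filter. *)
Lemma transmission_restrict D O lam1 lam2 mu u sigma :
  open D -> open O -> D `<=` O ->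
  (forall x, sigma x = stress2 D lam1 lam2 mu u x) ->
  transmission_system D setT lam1 lam2 mu u sigma ->
  transmission_system D O lam1 lam2 mu (u \_ (closure O)) (sigma \_ (closure O)).
Proof.
move=> Do Oo DO sE [[us1 us2 uc] l1 l2 _ tr].
have Eo : open (O `\` closure D).
  by apply: openI => //; apply: closed_openC; exact: closed_closure.
have uE x : closure O x -> u x = (u \_ (closure O)) x.
  by move=> Ox; rewrite patchE mem_set.
have sgE x : closure O x -> sigma x = (sigma \_ (closure O)) x.
  by move=> Ox; rewrite patchE mem_set.
have uD x : D x -> u x = (u \_ (closure O)) x.
  by move=> Dx; apply: uE; apply: subset_closure; exact: DO.
have uED x : (O `\` closure D) x -> u x = (u \_ (closure O)) x.
  by move=> [Ox _]; apply: uE; exact: subset_closure.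
have us2' : smooth_on (O `\` closure D) u.
  by apply: smooth_on_subset us2 => x [].
split.
- split; [exact: open_eq_smooth_on us1|exact: open_eq_smooth_on us2'|].
  apply: (@subspace_eq_continuous _ _ _ u).
    by move=> x; rewrite inE => /uE.
  by apply: continuous_subspaceW uc; exact: closureS.
- by move=> x Dx; rewrite -(open_eq_lame Do lam1 mu uD Dx); exact: l1.
- by move=> x Ex; rewrite -(open_eq_lame Eo lam2 mu uED Ex); apply: l2; case: Ex.
- move=> x Ex; rewrite -sgE; last by apply: subset_closure; case: Ex.
  rewrite sE; case: (setD_bdry_sub Ex) => [Dx|EDx].
    have E := open_eq_stress Do lam1 mu uD Dx.
    by rewrite !stress2_in.
  have nDx : ~ D x by case: EDx => _ nD /subset_closure.
  have E := open_eq_stress Eo lam2 mu uED EDx.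
  by rewrite !stress2_notin.
- move=> p /tr[t [t1 t2]]; exists t; split.
    apply: near_eq_cvg_to t1; rewrite near_withinE; apply: nearW => x Dx.
    by rewrite /traction sgE//; apply: subset_closure; exact: DO.
  have t2' : traction sigma (normal D p) x
      @[x --> within (O `\` closure D) (nbhs p)] --> t.
    by apply: cvg_within_subset t2 => x [].
  apply: near_eq_cvg_to t2'; rewrite near_withinE; apply: nearW => x [Ox _].
  by rewrite /traction sgE//; exact: subset_closure.
Qed.

(** Either [p] is off [closure D], where [u] is smooth with moduli [lam2], or
    [p] lies on [bdry D], since it is not in [D]. In the second case the
    normals of [D] and [O] at [p] coincide and [t] is the common traction given
    by the transmission condition: inside [O] it is the limit from both phases,
    and outside [closure O] only the second phase is present. *)
Lemma traction_limit D O lam1 lam2 mu u sigma p :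
  open D -> open O -> smooth_boundary D -> smooth_boundary O -> D `<=` O ->
  (forall x, sigma x = stress2 D lam1 lam2 mu u x) ->
  transmission_system D setT lam1 lam2 mu u sigma -> bdry O p ->
  exists t : V,
    traction sigma (normal O p) x @[x --> within (O `\` bdry D) (nbhs p)] --> t /\
    traction (stress lam2 mu u) (normal O p) x
      @[x --> within (~` closure O) (nbhs p)] --> t.
Proof.
move=> Do Oo Ds Os DO sE [[us1 us2 _] _ _ _ tr] bO.
rewrite setTD in us2.
have Co : open (~` closure D) by apply: closed_openC; exact: closed_closure.
have sC x : ~ closure D x -> stress lam2 mu u x = sigma x.
  by move=> nD; rewrite sE stress2_notin// => /subset_closure.
have OC : ~` closure O `<=` ~` closure D by apply: subsetC; exact: closureS.
have [cD|nD] := pselect (closure D p).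
  have bD : bdry D p.
    by apply: notin_bdry => // Dp; apply: (bdry_notin Oo bO); exact: DO.
  have [t [t1 t2]] := tr p bD.
  rewrite (normal_subset Do Oo Ds Os DO bD bO) in t1 t2.
  exists t; split.
    have t2' : traction sigma (normal O p) x
        @[x --> within (O `\` closure D) (nbhs p)] --> t.
      by apply: cvg_within_subset t2 => x [].
    by apply: cvg_within_subset (cvg_withinU t1 t2'); exact: setD_bdry_sub.
  apply: (@near_eq_cvg_to _ _ _ _ (traction sigma (normal O p))).
    rewrite near_withinE; apply: nearW => x /OC nDx.
    by rewrite /traction sC.
  by apply: cvg_within_subset t2 => x /OC.
have tc := traction_continuous (lam := lam2) (mu := mu) (n := normal O p)
  Co us2 nD.
exists (traction (stress lam2 mu u) (normal O p) p).
split; apply: cvg_within_filter.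
  apply: near_eq_cvg_to tc; apply: near_open Co _ nD => x nDx.
  by rewrite /traction sC.
exact: tc.
Qed.

(** For [enorm x >= 1] the bound is at most [`|C| / enorm x]. *)
Lemma decays_like_lt v k : decays_like v (- k.+1%:Z) ->
  forall e : R, 0 < e -> exists M : R, forall x, M <= enorm x -> enorm (v x) < e.
Proof.
move=> [C [M CM]] e e0.
exists (Num.max (Num.max M 1) (`|C| / e + 1)) => x.
rewrite !ge_max => /andP[/andP[Mx x1] Cx].
have x0 : 0 < enorm x by exact: lt_le_trans x1.
apply: le_lt_trans (CM x Mx) _.
apply: (@le_lt_trans _ _ (`|C| * (enorm x)^-1)).
  apply: (@le_trans _ _ (`|C| * enorm x ^ (- k.+1%:Z))).
    by apply: ler_wpM2r; [apply: exprz_ge0; exact: ltW|exact: ler_norm].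
  apply: ler_wpM2l => //.
  rewrite -exprnN lef_pV2 ?posrE ?exprn_gt0//.
  by rewrite ler_eXnr.
rewrite ltr_pdivrMr// -ltr_pdivrMl// mulrC.
by apply: lt_le_trans Cx; rewrite ltrDl.
Qed.

End Elasticity.

(** * The equivalent boundary value problem in [Omega] *)

Theorem theorem4p3 (R : realType) (d : nat) (hd : d = 2%N \/ d = 3%N)
  (D Omega : set 'rV[R]_d)
  (D_open : open D) (D_bounded : bounded_set D) (D_smooth : smooth_boundary D)
  (Omega_open : open Omega) (Omega_bounded : bounded_set Omega)
  (Omega_smooth : smooth_boundary Omega)
  (DOmega : D `<=` Omega)
  (mu lam1 lam2 lamE : R) (mu_gt0 : 0 < mu)
  (lam1_gt : 0 < d%:R * lam1 + 2 * mu) (lam2_gt : 0 < d%:R * lam2 + 2 * mu)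
  (lamE_def : lamE = lam2)
  (Cg : R) (Cg_neq0 : Cg != 0)
  (gh : 'rV[R]_d -> R) (gh_smooth : smooth_on setT gh)
  (gh_harmonic : forall x, laplacian gh x = 0)
  (g : 'rV[R]_d -> R) (g_def : forall x, g x = Cg / 2 * dotv x x + gh x)
  (f : 'rV[R]_d -> 'rV[R]_d) (f_def : forall x, f x = grad g x)
  (u : 'rV[R]_d -> 'rV[R]_d) (sigma : 'rV[R]_d -> 'M[R]_d)
  (sigma_def : forall x, sigma x = stress2 D lam1 lam2 mu u x)
  (u_system : transmission_system D setT lam1 lam2 mu u sigma)
  (u_infty : decays_like (u \- f) (1 - d%:Z)) :
  let uI := u \_ (closure Omega) in
  let sigmaI := sigma \_ (closure Omega) in
  let uI_bd := trace Omega uI in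
  let tI_bd := traction_trace Omega (Omega `\` bdry D) sigmaI in
  let f0 := trace (~` closure Omega) f in
  let F0 := traction_trace Omega (~` closure Omega) (stress lam2 mu f) in
  [/\ transmission_system D Omega lam1 lam2 mu uI sigmaI,
      (* the boundary limits from inside Omega exist *)
      (forall p, bdry Omega p ->
         cvg (uI x @[x --> within Omega (nbhs p)]) /\
         cvg (traction sigmaI (normal Omega p) x
                @[x --> within (Omega `\` bdry D) (nbhs p)])),
      (* the exterior problem with data uI - f0 is solvable, so that the
         Dirichlet-to-Neumann map is defined there *)
      DtN_graph Omega lamE mu (uI_bd \- f0) (tI_bd \- F0) &
      forall Lam, is_DtN_map Omega lamE mu Lam ->
        forall p, bdry Omega p -> Pbc Lam uI_bd tI_bd f0 F0 p = 0].
Proof.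
move=> uI sigmaI uI_bd tI_bd f0 F0; subst lamE.
have fE : f = grad g by exact/funext.
have gE : g = quad (Cg / 2) \+ gh by apply/funext => x; rewrite g_def.
have qs := @smooth_on_quad R d (Cg / 2).
have gs : smooth_on setT g by rewrite gE; apply: smooth_onD => //; exact: openT.
(* The quadratic part contributes Cg * d, and gh is harmonic. *)
have lapg x : laplacian g x = 2 * (Cg / 2) * d%:R.
  have gqE : forall y, setT y -> (g \- quad (Cg / 2)) y = gh y.
    by move=> y _; rewrite gE /= addrAC subrr add0r.
  have L := laplacianB openT gs qs I.
  have L' := open_eq_laplacian openT gqE I.
  have := L x; rewrite (L' x) gh_harmonic laplacian_quad => /esym/eqP.
  by rewrite subr_eq0 => /eqP.
have lame_f lam x : lame lam mu f x = 0.
  by rewrite fE; exact: lame_grad gs lapg x.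
have fs : smooth_on setT f.
  by rewrite fE; apply: smooth_on_grad => //; exact: openT.
have [[_ us uc] _ lame2 _ _] := u_system.
rewrite setTD in us lame2.
have ucont : continuous u.
  by move: uc; rewrite closureT => uc; exact/continuous_subspace_setT.
set E := ~` closure Omega.
have Eo : open E by apply: closed_openC; exact: closed_closure.
have EC : E `<=` ~` closure D by apply: subsetC; exact: closureS.
have uEs : smooth_on E u := smooth_on_subset EC us.
have fEs : smooth_on E f by apply: smooth_on_subset fs.
have uI_lim p : uI x @[x --> within Omega (nbhs p)] --> u p.
  have ul : u x @[x --> within Omega (nbhs p)] --> u p.
    by apply: cvg_within_filter; exact: ucont.
  apply: near_eq_cvg_to ul; rewrite near_withinE; apply: nearW => x Ox.
  by rewrite /uI patchE mem_set//; exact: subset_closure.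
have f_lim p : f x @[x --> within E (nbhs p)] --> f p.
  apply: cvg_within_filter; apply: differentiable_continuous.
  exact: smooth_on_differentiable fs I.
have tf_lim p n : traction (stress lam2 mu f) n x @[x --> within E (nbhs p)]
    --> traction (stress lam2 mu f) n p.
  apply: cvg_within_filter; exact: traction_continuous openT fs I.
have T p (bp : bdry Omega p) := traction_limit D_open Omega_open D_smooth
  Omega_smooth DOmega sigma_def u_system bp.
have TI p (t : 'rV[R]_d) : traction sigma (normal Omega p) x
      @[x --> within (Omega `\` bdry D) (nbhs p)] --> t ->
    traction sigmaI (normal Omega p) x
      @[x --> within (Omega `\` bdry D) (nbhs p)] --> t.
  move=> tl; apply: near_eq_cvg_to tl.
  rewrite near_withinE; apply: nearW => x [Ox _].
  by rewrite /traction /sigmaI patchE mem_set//; exact: subset_closure.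
have cO p : bdry Omega p -> closure Omega p by case.
have cE p : bdry Omega p -> closure E p by exact: bdry_closure_ext.
have cOD p (bp : bdry Omega p) := closure_setD_bdry D_open Omega_open (cO p bp).
have DtN : DtN_graph Omega lam2 mu (uI_bd \- f0) (tI_bd \- F0).
  exists (u \- f); last first.
    move=> p bp; have [t [t1 t2]] := T p bp.
    have -> : (tI_bd \- F0) p =
        t - traction (stress lam2 mu f) (normal Omega p) p.
      congr (_ - _); first exact: trace_eq (cOD p bp) (TI p t t1).
      exact: trace_eq (cE p bp) (tf_lim p _).
    apply: near_eq_cvg_to (cvgB t2 (tf_lim p _)).
    rewrite near_withinE; apply: nearW => x Ex.
    have tE := tractionB lam2 mu (normal Omega p) Eo uEs fEs Ex.
    exact: esym tE.
  split.
  - exact: smooth_onB.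
  - move=> x Ex; have L := lameB Eo lam2 mu uEs fEs Ex.
    by rewrite L lame_f lame2 ?subr0//; exact: EC.
  - move=> p bp.
    have -> : (uI_bd \- f0) p = u p - f p.
      congr (_ - _); first exact: trace_eq (cO p bp) (uI_lim p).
      exact: trace_eq (cE p bp) (f_lim p).
    apply: cvgB (f_lim p); apply: cvg_within_filter; exact: ucont.
  - have dE : 1 - d%:Z = - (d.-2.+1)%:Z by case: hd => ->.
    rewrite dE in u_infty => e e0.
    have [M MP] := decays_like_lt u_infty e0.
    by exists M => x _; exact: MP.
split => //.
- exact: transmission_restrict.
- move=> p bp; split; first by apply/cvg_ex; exists (u p); exact: uI_lim.
  by have [t [t1 _]] := T p bp; apply/cvg_ex; exists t; exact: TI.
- move=> Lam LamP p bp; have LE := LamP _ _ DtN p bp.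
  by rewrite /Pbc LE /= subKr subrr.
Qed.
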